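(* Let $A_1,\dots,A_m\in\mathbb{C}^{n\times n}$ be Hermitian matrices, let $h_1,\dots,h_m:\mathbb{R}\to\mathbb{R}$ be differentiable and non-decreasing, let $\phi_i$ be an anti-derivative of $h_i$ ($\phi_i'=h_i$), and put $H(x)=\sum_{i=1}^m h_i(x^HA_ix)A_i$, $\phi(y)=\sum_{i=1}^m\phi_i(y(i))$ for $y\in\mathbb{R}^m$, and $g(x)=[x^HA_1x,\dots,x^HA_mx]^T\in\mathbb{R}^m$ for $x\in\mathbb{C}^n$. Let $\{x_k\}_{k\ge0}$ be a sequence of unit vectors generated by the SCF iteration for $H$, and let $y_k:=g(x_k)$. Then for every $k\geq 0$, $$y_{k+1}\in\operatorname*{arg\,max}_{y\in W(\mathcal{A})}\ \nabla\phi(y_k)^Ty .$$ Therefore, geometrically, $y_{k+1}$ is a supporting point of $W(\mathcal{A})$ for the outer normal vector $\nabla\phi(y_k)$ (whenever $\nabla\phi(y_k)\neq0$, so that this notion is defined).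
   Context: $y(i)$ denotes the $i$-th entry of $y\in\mathbb{R}^m$, and $\nabla\phi(y)=[h_1(y(1)),\dots,h_m(y(m))]^T$. SCF iteration: starting from a unit vector $x_0\in\mathbb{C}^n$, for $k=0,1,2,\dots$ let $\lambda_{k+1}$ be the largest eigenvalue of the Hermitian matrix $H(x_k)$ and let $x_{k+1}$ be any corresponding unit eigenvector, i.e. $H(x_k)x_{k+1}=\lambda_{k+1}x_{k+1}$, $\|x_{k+1}\|=1$. The joint numerical range of the tuple $\mathcal{A}=(A_1,\dots,A_m)$ is $W(\mathcal{A})=\{\,g(x) : x\in\mathbb{C}^n,\ \|x\|=1\,\}\subset\mathbb{R}^m$. For a bounded closed set $\Omega\subset\mathbb{R}^m$ and a nonzero $v\in\mathbb{R}^m$, a vector $y_v\in\operatorname{arg\,max}_{y\in\Omega}v^Ty$ is called a supporting point of $\Omega$ for the outer normal vector $v$; the set $\{y\in\mathbb{R}^m : v^T(y-y_v)=0\}$ is then a supporting hyperplane of $\Omega$, i.e. $v^Ty\le v^Ty_v$ for all $y\in\Omega$ and $y_v\in\Omega$. *)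

(* Defs.v *)
From HB Require Import structures.
From mathcomp Require Import all_boot all_order all_algebra complex.
From mathcomp Require Import all_classical all_reals all_analysis.

Set Implicit Arguments.
Unset Strict Implicit.
Unset Printing Implicit Defensive.

Import Order.TTheory GRing.Theory Num.Theory.
Import numFieldNormedType.Exports.

Local Open Scope classical_set_scope.
Local Open Scope ring_scope.
Local Open Scope complex_scope.
Local Open Scope sesquilinear_scope.

Section Euclidean.
Context {R : realType} {m : nat}.

Definition dot (u v : 'cV[R]_m) : R := (u^T *m v) 0 0.

Definition gradient (f : 'cV[R]_m -> R) (y : 'cV[R]_m) : 'cV[R]_m :=
  \col_i 'D_(delta_mx i 0) f y.

Definition separable_sum (phi : 'I_m -> R -> R) (y : 'cV[R]_m) : R :=
  \sum_i phi i (y i 0).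

Definition argmax (Omega : set 'cV[R]_m) (f : 'cV[R]_m -> R) : set 'cV[R]_m :=
  [set y | Omega y /\ forall z, Omega z -> f z <= f y].

                                                                               
                     
Definition supporting_point (Omega : set 'cV[R]_m) (v y : 'cV[R]_m) : Prop :=
  [/\ bounded_set Omega, closed Omega, v != 0 & argmax Omega (dot v) y].

End Euclidean.

Section SCF.
Context {R : realType} {n : nat}.

                                                                            
                                                                       
Definition norm2 (x : 'cV[R[i]]_n) : R[i] := sqrtC (\sum_i `|x i 0| ^+ 2).

                                                 
Definition quad (M : 'M[R[i]]_n) (x : 'cV[R[i]]_n) : R :=
  complex.Re ((x^t* *m M *m x) 0 0).

                                                                              
                                                                      
Definition largest_eigenvalue (M : 'M[R[i]]_n) (lambda : R[i]) : Prop :=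
  eigenvalue M lambda /\ forall mu, eigenvalue M mu -> mu <= lambda.

Definition scf_sequence (H : 'cV[R[i]]_n -> 'M[R[i]]_n)
    (x : nat -> 'cV[R[i]]_n) : Prop :=
  norm2 (x 0%N) = 1 /\
  forall k, exists lambda : R[i],
    [/\ largest_eigenvalue (H (x k)) lambda,
        H (x k) *m x k.+1 = lambda *: x k.+1
      & norm2 (x k.+1) = 1].

Context {m : nat}.

Definition quad_map (A : 'I_m -> 'M[R[i]]_n) (x : 'cV[R[i]]_n) : 'cV[R]_m :=
  \col_i quad (A i) x.

Definition joint_numerical_range (A : 'I_m -> 'M[R[i]]_n) : set 'cV[R]_m :=
  [set quad_map A x | x in [set x | norm2 x = 1]].

Definition scf_matrix (A : 'I_m -> 'M[R[i]]_n) (h : 'I_m -> R -> R)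
    (x : 'cV[R[i]]_n) : 'M[R[i]]_n :=
  \sum_i (h i (quad (A i) x))%:C *: A i.

End SCF.

(* Main.v *)
Require Import Defs.
From HB Require Import structures.
From mathcomp Require Import all_boot all_order all_algebra complex.
From mathcomp Require Import all_classical all_reals all_analysis.

Set Implicit Arguments.
Unset Strict Implicit.
Unset Printing Implicit Defensive.

Import Order.TTheory GRing.Theory Num.Theory.
Import numFieldNormedType.Exports.

Local Open Scope classical_set_scope.
Local Open Scope ring_scope.
Local Open Scope complex_scope.
Local Open Scope sesquilinear_scope.

(** By linearity in the matrix, v^T g(z) is the Hermitian form of
sum_i v_i A_i at z ([dot_quad_map]).  As the gradient of phi at y is the vector
of the h_i(y_i) ([gradient_separable_sum]), the choice v = grad phi(g(x_k))
makes this matrix H(x_k): maximizing grad phi(y_k)^T y over W(A) is maximizing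
the Rayleigh quotient z^* H(x_k) z over the unit sphere.  The maximum is the
largest eigenvalue of H(x_k) ([quad_le_largest_eigenvalue], by diagonalization
in a unitary basis), and every unit eigenvector for it, such as x_{k+1}, attains
it ([quad_eigenvector]).

A supporting point also requires that W(A) be bounded and closed.  It is even
compact ([joint_numerical_range_compact]): splitting vectors into real and
imaginary parts exhibits W(A) as the image of the unit sphere of R^(2n) under a
polynomial map. *)

(** * Gradient of a separable sum *)

(** Moving y along the i-th basis vector changes the i-th summand only, so the
two difference quotients are the same function; no differentiability is
needed. *)
Lemma derive_separable_sum (R : realType) (m : nat) (phi : 'I_m -> R -> R)
    (y : 'cV[R]_m) (i : 'I_m) :
  'D_(delta_mx i 0) (separable_sum phi) y = 'D_1 (phi i) (y i 0).
Proof.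
rewrite /derive.
set q := (q in lim (q @ _) = _); set q' := (q' in _ = lim (q' @ _)).
suff -> : q = q' by [].
apply/funext => t; rewrite {}/q {}/q' /=.
rewrite /separable_sum -sumrB (bigD1 i) //= big1 ?addr0 => [|j ji].
  by rewrite !mxE !eqxx.
by rewrite !mxE (negbTE ji) mulr0 add0r subrr.
Qed.

Lemma gradient_separable_sum (R : realType) (m : nat) (h phi : 'I_m -> R -> R)
    (y : 'cV[R]_m) :
  (forall i (t : R), is_derive t (1 : R) (phi i) (h i t)) ->
  gradient (separable_sum phi) y = \col_i h i (y i 0).
Proof.
move=> phi_h; apply/colP => i; rewrite !mxE derive_separable_sum.
exact: derive_val.
Qed.

(** * The linear functionals of the joint numerical range *)

Lemma Re_sum (R : realType) (I : Type) (r : seq I) (F : I -> R[i]) :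
  complex.Re (\sum_(i <- r) F i) = \sum_(i <- r) complex.Re (F i).
Proof. by apply: (big_morph (@complex.Re R)) => // -[a b] [c d]. Qed.

Lemma Re_realM (R : realType) (c : R) (z : R[i]) :
  complex.Re (c%:C * z) = c * complex.Re z.
Proof. by case: z => a b /=; rewrite mul0r subr0. Qed.

Lemma dot_quad_map (R : realType) (n m : nat) (A : 'I_m -> 'M[R[i]]_n)
    (c : 'I_m -> R) (z : 'cV[R[i]]_n) :
  dot (\col_i c i) (quad_map A z) = quad (\sum_i (c i)%:C *: A i) z.
Proof.
rewrite /dot /quad mulmx_sumr mulmx_suml summxE Re_sum mxE.
apply: eq_bigr => i _.
rewrite -scalemxAr -scalemxAl [in RHS]mxE Re_realM [in LHS]mxE [in LHS]mxE.
by congr (_ * _); rewrite mxE.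
Qed.

Lemma scf_matrix_hermitian (R : realType) (n m : nat)
    (A : 'I_m -> 'M[R[i]]_n) (h : 'I_m -> R -> R) (z : 'cV[R[i]]_n) :
  (forall i, A i \is hermsymmx) -> scf_matrix A h z \is hermsymmx.
Proof.
move=> A_herm; apply/is_hermitianmxP/matrixP => j k; rewrite expr0 scale1r.
rewrite !mxE !summxE rmorph_sum; apply: eq_bigr => i _.
have /is_hermitianmxP/matrixP/(_ j k) := A_herm i.
rewrite expr0 scale1r !mxE => ->; rewrite rmorphM; congr (_ * _).
exact/esym/conjc_real.
Qed.

(** * Rayleigh quotients of Hermitian matrices *)

Lemma norm2_eq1 (R : realType) (n : nat) (z : 'cV[R[i]]_n) :
  norm2 z = 1 <-> (z^t* *m z) 0 0 = 1.
Proof.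
have -> : (z^t* *m z) 0 0 = \sum_i `|z i 0| ^+ 2.
  by rewrite mxE; apply: eq_bigr => i _; rewrite !mxE mulrC -normCK.
rewrite /norm2; split=> [z1|->]; last exact: sqrtC1.
by rewrite -[LHS]sqrtCK z1 expr1n.
Qed.

Lemma quad_eigenvector (R : realType) (n : nat) (M : 'M[R[i]]_n) (l : R[i])
    (z : 'cV[R[i]]_n) :
  norm2 z = 1 -> M *m z = l *: z -> quad M z = complex.Re l.
Proof.
move=> /norm2_eq1 z1 Mz.
by rewrite /quad -mulmxA Mz -scalemxAr mxE z1 mulr1.
Qed.

(** In the coordinates w = P z of a unitary diagonalization M = P^-1 D P, the
form is a weighted mean, with weights |w_i|^2, of the eigenvalues d_i. *)
Lemma quad_le_largest_eigenvalue (R : realType) (n : nat) (M : 'M[R[i]]_n)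
    (l : R[i]) (z : 'cV[R[i]]_n) :
  M \is hermsymmx -> largest_eigenvalue M l -> norm2 z = 1 ->
  quad M z <= complex.Re l.
Proof.
move=> /hermitian_normalmx/orthomx_spectralP ME [_ l_max] /norm2_eq1 z1.
pose P := spectralmx M; pose d := spectral_diag M.
have Pu : P \is unitarymx := spectral_unitarymx M.
have d_le i : d 0 i <= l.
  apply/l_max/eigenvalueP; exists (row i P).
    rewrite -row_mul [in LHS]ME !mulmxA mulmxV ?spectral_unit // mul1mx.
    by rewrite row_mul row_diag_mx -scalemxAl -rowE.
  (* A zero row would make the determinant of P vanish. *)
  apply: contraTneq (spectral_unit M) => Pi0.
  rewrite unitmxE (expand_det_row _ i) big1 ?unitr0 // => j _.
  by move/rowP/(_ j): Pi0; rewrite !mxE => ->; rewrite mul0r.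
pose w := P *m z.
have wE : w^t* = z^t* *m invmx P.
  by rewrite invmx_unitary // /w trmx_mul map_mxM.
have w1 : \sum_i `|w i 0| ^+ 2 = 1.
  rewrite -z1 -[X in _ *m X](mulKmx (spectral_unit M) z) -/P -/w mulmxA -wE mxE.
  by apply: eq_bigr => i _; rewrite !mxE mulrC -normCK.
have -> : quad M z = complex.Re (\sum_i d 0 i * `|w i 0| ^+ 2).
  rewrite /quad ME !mulmxA -wE -mulmxA -/P -/w mxE; congr complex.Re.
  apply: eq_bigr => i _; rewrite mul_mx_diag !mxE normCK.
  by rewrite mulrAC mulrC [X in _ * X]mulrC.
have : \sum_i d 0 i * `|w i 0| ^+ 2 <= l.
  rewrite -[leRHS]mulr1 -w1 mulr_sumr; apply: ler_sum => i _.
  by rewrite ler_wpM2r ?exprn_ge0.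
(* In the order of the complex numbers, comparable elements have equal imaginary
   parts and ordered real parts. *)
by rewrite lecE => /andP[].
Qed.

(** * Compactness of the joint numerical range *)

(** The vector of C^n whose real parts are the first n entries of v and whose
imaginary parts are the last n. Real row vectors are used since their boxes are
compact by [rV_compact]. *)
Definition complex_col (R : realType) (n : nat) (v : 'rV[R]_(n + n)) :
    'cV[R[i]]_n :=
  \col_i (v 0 (lshift n i) +i* v 0 (rshift n i)).

Lemma continuous_sum (R : realType) (T : topologicalType) (V : normedModType R)
    (I : Type) (r : seq I) (F : I -> T -> V) :
  (forall i, continuous (F i)) ->
  continuous (fun t => \sum_(i <- r) F i t).
Proof.
move=> Fc; apply: (@continuous_big _ _ _ _ xpredT) => // t.
exact: add_continuous.
Qed.

(** With x = a + i b, y = c + i d and M = p + i q, this is the real part of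
conj(x) M y, as a function of the real and imaginary parts. *)
Lemma continuous_Re_mul (R : realType) (T : topologicalType) (p q : R)
    (a b c d : T -> R) :
  continuous a -> continuous b -> continuous c -> continuous d ->
  continuous (fun t => (a t * p + b t * q) * c t - (a t * q - b t * p) * d t).
Proof.
move=> ac bc cc dc t.
apply: cvgB; apply: cvgM; [|exact: cc| |exact: dc].
  apply: cvgD; apply: cvgMr_tmp; [exact: ac|exact: bc].
apply: cvgB; apply: cvgMr_tmp; [exact: ac|exact: bc].
Qed.

Lemma quad_complex_col_continuous (R : realType) (n : nat) (M : 'M[R[i]]_n) :
  continuous (fun v : 'rV[R]_(n + n) => quad M (complex_col v)).
Proof.
pose re k v : R := (v : 'rV[R]_(n + n)) 0 (lshift n k).
pose im k v : R := (v : 'rV[R]_(n + n)) 0 (rshift n k).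
have -> : (fun v => quad M (complex_col v)) = fun v => \sum_k \sum_j
    ((re j v * complex.Re (M j k) + im j v * complex.Im (M j k)) * re k v
     - (re j v * complex.Im (M j k) - im j v * complex.Re (M j k)) * im k v).
  apply/funext => v; rewrite /quad mxE Re_sum; apply: eq_bigr => k _.
  rewrite mxE mulr_suml Re_sum; apply: eq_bigr => j _; rewrite !mxE.
  by case: (M j k) => a b /=; rewrite /re /im !mulNr !opprK.
have coordc (l : 'I_(n + n)) : continuous (fun v : 'rV[R]_(n + n) => v 0 l).
  exact: coord_continuous.
apply: continuous_sum => k; apply: continuous_sum => j.
exact: (continuous_Re_mul (coordc (lshift n j)) (coordc (rshift n j))
  (coordc (lshift n k)) (coordc (rshift n k))).
Qed.

Lemma quad_map_complex_col_continuous (R : realType) (n m : nat)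
    (A : 'I_m -> 'M[R[i]]_n) :
  continuous (fun v : 'rV[R]_(n + n) => quad_map A (complex_col v)).
Proof.
have -> : (fun v => quad_map A (complex_col v)) =
    fun v => \sum_i quad (A i) (complex_col v) *: (delta_mx i 0 : 'cV[R]_m).
  apply/funext => v; rewrite [LHS]matrix_sum_delta; apply: eq_bigr => i _.
  by rewrite big_ord1 mxE.
apply: continuous_sum => i v.
apply: (@continuousZr_tmp R _ _ (fun v => quad (A i) (complex_col v))).
exact: (@quad_complex_col_continuous R n (A i) v).
Qed.

Lemma norm2_complex_col (R : realType) (n : nat) (v : 'rV[R]_(n + n)) :
  norm2 (complex_col v) = 1 <-> \sum_j v 0 j ^+ 2 = 1.
Proof.
rewrite norm2_eq1.
have -> : ((complex_col v)^t* *m complex_col v) 0 0 = (\sum_j v 0 j ^+ 2)%:C.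
  rewrite big_split_ord /= -big_split /= mxE rmorph_sum.
  by apply: eq_bigr => i _; rewrite !mxE mulrC -normCK -add_Re2_Im2.
by split=> [[]|->].
Qed.

Lemma joint_numerical_range_compact (R : realType) (n m : nat)
    (A : 'I_m -> 'M[R[i]]_n) :
  compact (joint_numerical_range A).
Proof.
pose S := [set v : 'rV[R]_(n + n) | \sum_j v 0 j ^+ 2 = 1].
have -> : joint_numerical_range A = (fun v => quad_map A (complex_col v)) @` S.
  apply/seteqP; split => [_ [z z1 <-]|_ [v v1 <-]]; last first.
    by exists (complex_col v) => //; exact/norm2_complex_col.
  pose v := row_mx (\row_i complex.Re (z i 0)) (\row_i complex.Im (z i 0)).
  have vz : complex_col v = z.
    apply/colP => i; rewrite mxE row_mxEl row_mxEr !mxE.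
    by case: (z i 0).
  by exists v; rewrite ?vz //; apply/norm2_complex_col; rewrite vz.
apply: continuous_compact.
  exact/continuous_subspaceT/quad_map_complex_col_continuous.
have S_closed : closed S.
  apply: (@preimage_closed _ _
    (fun v : 'rV[R]_(n + n) => \sum_j v 0 j ^+ 2) [set 1]).
    move=> v _; apply: continuous_sum => j w.
    have coordc : continuous (fun u : 'rV[R]_(n + n) => u 0 j).
      exact: coord_continuous.
    exact: (continuousM (coordc w) (coordc w)).
  exact/accessible_closed_set1/hausdorff_accessible.
(* The unit sphere is a closed subset of the box [-1, 1]^(2n). *)
have box := @rV_compact R (n + n) (fun=> `[-1, 1]%classic)
  (fun=> @segment_compact _ _ _).
apply: subclosed_compact S_closed box _ => v v1 j /=.
rewrite in_itv /= -ler_norml -(@expr_le1 _ 2) //.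
rewrite real_normK ?num_real // -v1 (bigD1 j) //= lerDl.
by apply: sumr_ge0 => k _; exact: sqr_ge0.
Qed.

Theorem theorem3p1 (R : realType) (n m : nat)
    (A : 'I_m -> 'M[R[i]]_n) (h phi : 'I_m -> R -> R)
    (x : nat -> 'cV[R[i]]_n)
    (A_herm : forall i, A i \is hermsymmx)
    (h_diff : forall i (t : R), derivable (h i) t 1)
    (h_ndecr : forall i, {homo h i : s t / s <= t})
    (phi_antideriv : forall i (t : R), is_derive t (1 : R) (phi i) (h i t))
    (x_scf : scf_sequence (scf_matrix A h) x) :
  let y k := quad_map A (x k) in
  let grad k := gradient (separable_sum phi) (y k) in
  forall k : nat,
    argmax (joint_numerical_range A) (dot (grad k)) (y k.+1) /\
    (grad k != 0 -> supporting_point (joint_numerical_range A) (grad k) (y k.+1)).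
Proof.
move=> y grad k; have [_ /(_ k) [l [l_max xk_eig xk1]]] := x_scf.
have grad_quad z : dot (grad k) (quad_map A z) = quad (scf_matrix A h (x k)) z.
  rewrite /grad (gradient_separable_sum _ phi_antideriv) dot_quad_map.
  by congr quad; apply: eq_bigr => i _; rewrite mxE.
have y_argmax : argmax (joint_numerical_range A) (dot (grad k)) (y k.+1).
  split=> [|_ [z z1 <-]]; first by exists (x k.+1).
  rewrite !grad_quad (quad_eigenvector xk1 xk_eig).
  exact/quad_le_largest_eigenvalue/z1/l_max/scf_matrix_hermitian.
split=> // grad_neq0; split=> //.
  exact/compact_bounded/joint_numerical_range_compact.
exact: (compact_closed (@norm_hausdorff R 'cV[R]_m)
  (@joint_numerical_range_compact R n m A)).
Qed.
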